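(* Let $K$ be a field, $R=K[x_1,\ldots,x_8]$, and let $I\subset R$ be the ideal generated by the following 44 monomials: $x_1x_2x_3x_4$, $x_1x_2x_3x_5$, $x_1x_2x_3x_6$, $x_1x_2x_3x_8$, $x_1x_2x_4x_7$, $x_1x_2x_5x_7$, $x_1x_2x_6x_7$, $x_1x_2x_7x_8$, $x_1x_3x_4x_7$, $x_1x_3x_4x_8$, $x_1x_3x_5x_7$, $x_1x_3x_5x_8$, $x_1x_3x_6x_7$, $x_1x_3x_6x_8$, $x_1x_3x_7x_8$, $x_1x_4x_7x_8$, $x_1x_5x_7x_8$, $x_1x_6x_7x_8$, $x_2x_3x_4x_5$, $x_2x_3x_4x_6$, $x_2x_3x_4x_7$, $x_2x_3x_5x_6$, $x_2x_3x_5x_7$, $x_2x_3x_5x_8$, $x_2x_3x_6x_7$, $x_2x_3x_6x_8$, $x_2x_3x_7x_8$, $x_2x_4x_5x_7$, $x_2x_4x_6x_7$, $x_2x_5x_6x_7$, $x_2x_5x_7x_8$, $x_2x_6x_7x_8$, $x_3x_4x_5x_7$, $x_3x_4x_5x_8$, $x_3x_4x_6x_7$, $x_3x_4x_6x_8$, $x_3x_4x_7x_8$, $x_3x_5x_6x_7$, $x_3x_5x_6x_8$, $x_3x_5x_7x_8$, $x_3x_6x_7x_8$, $x_4x_5x_7x_8$, $x_4x_6x_7x_8$, $x_5x_6x_7x_8$. Then $I$ is a matroidal ideal such that $\operatorname{astab}(I)=3$ and $\operatorname{dstab}(I)=2$.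
   Context: For a monomial ideal $I$, $G(I)$ denotes its unique minimal set of monomial generators and $\deg_{x_i}(u)$ is the exponent of $x_i$ in the monomial $u$. A monomial ideal $I$ generated in a single degree is polymatroidal if for all $u,v\in G(I)$ with $\deg_{x_i}(u)>\deg_{x_i}(v)$ there is an index $j$ with $\deg_{x_j}(v)>\deg_{x_j}(u)$ and $x_j(u/x_i)\in G(I)$. A matroidal ideal is a square-free polymatroidal ideal. $\operatorname{Ass}(I)$ denotes the set of associated primes of $R/I$. $\operatorname{astab}(I)$ is the smallest integer $l\ge 1$ with $\operatorname{Ass}(I^t)=\operatorname{Ass}(I^l)$ for all $t\ge l$, and $\operatorname{dstab}(I)$ is the smallest integer $k\ge1$ with $\operatorname{depth} R/I^s=\operatorname{depth} R/I^k$ for all $s\ge k$ (both exist by results of Brodmann). *)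

(* Defs.v *)
From HB Require Import structures.
From mathcomp Require Import all_boot all_order all_algebra.
From mathcomp Require Import boolp classical_sets.
From mathcomp Require Import mpoly.

Set Implicit Arguments.
Unset Strict Implicit.
Unset Printing Implicit Defensive.

Import GRing.Theory.
Local Open Scope ring_scope.
Local Open Scope classical_set_scope.

(* Ideals are Prop-valued sets; P is moved to the Boolean predicates of
   ring_quotient classically, through membership in a set. *)
Definition prime_ideal (R : comNzRingType) (P : set R) : Prop :=
  idealr_closed [pred x | x \in P] /\ prime_idealr_closed [pred x | x \in P].

Definition ideal_gen (R : comNzRingType) (S : set R) : set R :=
  [set x | exists2 s : seq (R * R),
     (forall p, p \in s -> S p.2) & x = \sum_(p <- s) p.1 * p.2].

Definition ideal_pow (R : comNzRingType) (I : set R) (t : nat) : set R :=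
  ideal_gen [set x | exists2 f : 'I_t -> R,
     (forall i, I (f i)) & x = \prod_(i < t) f i].

(* Ass(I), the associated primes of R/I: the primes of the form (I : f), which
   is the annihilator of the class of f. *)
Definition Ass (R : comNzRingType) (I : set R) : set (set R) :=
  [set P | prime_ideal P /\ exists f : R, P = [set g | I (g * f)]].

(* s is an (R/J)-regular sequence. *)
Definition regular_seq (R : comNzRingType) (J : set R) (s : seq R) : Prop :=
  (forall i, (i < size s)%N -> forall g,
     ideal_gen (J `|` [set` take i s]) (s`_i * g) ->
     ideal_gen (J `|` [set` take i s]) g) /\
  ~ ideal_gen (J `|` [set` s]) 1.

Definition least (P : set nat) (k : nat) : Prop :=
  P k /\ forall j, P j -> (k <= j)%N.

Section Polynomials.
Variables (K : fieldType) (n : nat).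
Local Notation R := {mpoly K[n]}.

Definition monomial_ideal_gen (G : set 'X_{1..n}) : set R :=
  ideal_gen [set 'X_[u] | u in G].

(* G is G(I); the existence of such a G says that I is a monomial ideal. *)
Definition minimal_monomial_gens (I : set R) (G : set 'X_{1..n}) : Prop :=
  I = monomial_ideal_gen G /\
  forall H : set 'X_{1..n}, H `<=` G -> I = monomial_ideal_gen H -> H = G.

Definition polymatroidal (I : set R) : Prop :=
  exists G : set 'X_{1..n},
    [/\ minimal_monomial_gens I G,
        exists d : nat, forall u, G u -> mdeg u = d &
        forall u v, G u -> G v -> forall i : 'I_n, (v i < u i)%N ->
          exists j : 'I_n, (u j < v j)%N /\ G (u - U_(i) + U_(j))%MM].

Definition squarefree (I : set R) : Prop :=
  exists G : set 'X_{1..n},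
    minimal_monomial_gens I G /\ forall u, G u -> forall i : 'I_n, (u i <= 1)%N.

Definition matroidal (I : set R) : Prop := squarefree I /\ polymatroidal I.

Definition irrelevant_ideal : set R := ideal_gen [set 'X_i | i in [set: 'I_n]].

(* depth R/J = d: the supremum of the lengths of (R/J)-regular sequences in
   (x_1, ..., x_n) is attained and equal to d. *)
Definition depth_quot (J : set R) (d : nat) : Prop :=
  (exists s : seq R,
     [/\ [set` s] `<=` irrelevant_ideal, regular_seq J s & size s = d]) /\
  forall s : seq R,
    [set` s] `<=` irrelevant_ideal -> regular_seq J s -> (size s <= d)%N.

Definition astab (I : set R) (l : nat) : Prop :=
  least [set l | (1 <= l)%N /\ forall t, (l <= t)%N ->
     Ass (ideal_pow I t) = Ass (ideal_pow I l)] l.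

(* depth_quot is a functional relation, so a common value d says that
   depth R/I^s = depth R/I^k for all s >= k. *)
Definition dstab (I : set R) (k : nat) : Prop :=
  least [set k | (1 <= k)%N /\ exists d, forall s, (k <= s)%N ->
     depth_quot (ideal_pow I s) d] k.

End Polynomials.

(* The squarefree monomial in 8 variables whose support is listed by 1-based
   indices: x_i is the variable 'X_j with j : 'I_8 of value i - 1. *)
Definition mnm_of_support (s : seq nat) : 'X_{1..8} :=
  [multinom count_mem (val i).+1 s | i < 8].

Definition supports44 : seq (seq nat) :=
  [:: [:: 1; 2; 3; 4]; [:: 1; 2; 3; 5]; [:: 1; 2; 3; 6]; [:: 1; 2; 3; 8];
      [:: 1; 2; 4; 7]; [:: 1; 2; 5; 7]; [:: 1; 2; 6; 7]; [:: 1; 2; 7; 8];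
      [:: 1; 3; 4; 7]; [:: 1; 3; 4; 8]; [:: 1; 3; 5; 7]; [:: 1; 3; 5; 8];
      [:: 1; 3; 6; 7]; [:: 1; 3; 6; 8]; [:: 1; 3; 7; 8]; [:: 1; 4; 7; 8];
      [:: 1; 5; 7; 8]; [:: 1; 6; 7; 8]; [:: 2; 3; 4; 5]; [:: 2; 3; 4; 6];
      [:: 2; 3; 4; 7]; [:: 2; 3; 5; 6]; [:: 2; 3; 5; 7]; [:: 2; 3; 5; 8];
      [:: 2; 3; 6; 7]; [:: 2; 3; 6; 8]; [:: 2; 3; 7; 8]; [:: 2; 4; 5; 7];
      [:: 2; 4; 6; 7]; [:: 2; 5; 6; 7]; [:: 2; 5; 7; 8]; [:: 2; 6; 7; 8];
      [:: 3; 4; 5; 7]; [:: 3; 4; 5; 8]; [:: 3; 4; 6; 7]; [:: 3; 4; 6; 8];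
      [:: 3; 4; 7; 8]; [:: 3; 5; 6; 7]; [:: 3; 5; 6; 8]; [:: 3; 5; 7; 8];
      [:: 3; 6; 7; 8]; [:: 4; 5; 7; 8]; [:: 4; 6; 7; 8]; [:: 5; 6; 7; 8]]%N.

Definition ideal44 (K : fieldType) : set {mpoly K[8]} :=
  monomial_ideal_gen [set mnm_of_support s | s in [set` supports44]].

Arguments irrelevant_ideal K n : clear implicits.
Arguments ideal44 K : clear implicits.

(* Main.v *)
Require Import Defs.
From mathcomp Require Import all_boot all_order all_algebra.
From mathcomp Require Import boolp classical_sets.
From mathcomp Require Import mpoly.

(** Write P_S for the ideal generated by the variables x_i, i in S. The powers
    of a monomial ideal I = (x^g, g in G) are again monomial: x^v lies in I^t
    iff v dominates a sum of t members of G ([ideal_powE]). When G is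
    squarefree, P is associated to I^t iff P = P_S for some S for which there
    is an exponent v with x^v outside I^t, with x_i x^v in I^t for all i in S,
    and with v_i >= t for i outside S ([Ass_ideal_powP]). The exponents outside
    S are then so large that they no longer restrict membership in I^t, so
    that x^v represents a socle element of the localization of R/I^t at P_S.
    This turns both stability indices into questions about the matroid M on
    {1, ..., 8} whose bases are the 44 supports.

    Localizing at P_S contracts the complement F of S. If F is not a flat,
    then M/F has a loop, the corresponding variable does not occur in the
    localized ideal, and P_S is never associated ([not_socle_loop]). If M/F
    is a direct sum, then the localized ideal is a product of ideals in
    disjoint sets of variables, and P_S is never associated either
    ([not_socle_separation]); among the proper flats this happens only for
    F = {1, 2}. For the other 49 proper flats P_S is associated to all large
    powers. Here degrees help: if every base meets S in at least r elements
    and the S-degree of x^v is less than t r, then x^v is not in I^t. Such a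
    certificate passes from I^t to I^(t+1) on multiplying x^v by a generator
    of minimal S-degree ([socle_certS]). A finite search
    ([socle44_classification]) finds certificates for the square of I for all
    of these flats but F = {4}. In M/4 the parallel classes are
    {3}, {7}, {2, 8}, {1, 5, 6}, and the bases are the transversals of three
    of the four classes. So x^v lies in the t-th power of the localized ideal
    iff the sum over the four classes of min(c_k, t) is at least 3 t, where
    c_k is the degree of v in the k-th class. Suppose t = 2 and
    every variable of S moves x^v into the ideal, while x^v is not in it. Then
    all c_k are at most 1, so their sum is at most 4, and a single variable
    cannot raise it to 6. ([not_socle2_1235678] checks this on all candidates
    for v.) For t = 3 the class degrees (2, 2, 2, 2) form a certificate
    ([socle_1235678]). Hence Ass(I^t) is constant from t = 3 on, but differs
    for t = 2.

    The maximal ideal is the case S = {1, ..., 8}, F empty, which has a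
    certificate at t = 2. So R/I^t has depth 0 for all t >= 2
    ([depth_quot_socle]), while the sum of the variables is a nonzerodivisor
    on R/I, because I is an intersection of primes P_S with S not everything
    ([regular_sum_variables]). Hence the depth is constant from t = 2 on, but
    not from t = 1. *)

Set Implicit Arguments.
Unset Strict Implicit.
Unset Printing Implicit Defensive.

Import GRing.Theory.

(** * Ideals generated by a set *)

Section IdealGeneration.
Local Open Scope ring_scope.
Local Open Scope classical_set_scope.
Variable R : comNzRingType.
Implicit Types (S J : set R) (x y a : R).

(** Unlike [idealr_closed], this admits the unit ideal, which is needed for
    the powers with exponent 0 and for ideals not yet known to be proper. *)
Definition is_ideal J : Prop :=
  [/\ J 0, forall x y, J x -> J y -> J (x + y) & forall a x, J x -> J (a * x)].

Lemma ideal_gen_sub S : S `<=` ideal_gen S.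
Proof.
move=> x Sx; exists [:: (1, x)]; last by rewrite big_seq1 mul1r.
by move=> p; rewrite inE => /eqP->.
Qed.

Lemma ideal_gen_ideal S : is_ideal (ideal_gen S).
Proof.
split=> [|x y [s sS ->] [r rS ->]|a x [s sS ->]].
- by exists [::]; rewrite ?big_nil.
- by exists (s ++ r) => [p|]; rewrite ?big_cat // mem_cat => /orP[/sS|/rS].
exists [seq (a * p.1, p.2) | p <- s] => [p /mapP[q /sS Sq ->] //|].
by rewrite big_map mulr_sumr; apply: eq_bigr => p _; rewrite mulrA.
Qed.

Lemma is_ideal_sum J (I : eqType) (s : seq I) (P : pred I) (F : I -> R) :
  is_ideal J -> (forall i, i \in s -> P i -> J (F i)) ->
  J (\sum_(i <- s | P i) F i).
Proof.
move=> [J0 JD _] JF; rewrite big_seq_cond.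
by apply: big_ind => // i /andP[]; apply: JF.
Qed.

Lemma is_ideal_subr J x y : is_ideal J -> J x -> J (x + y) -> J y.
Proof.
move=> [_ JD JM] Jx Jxy; rewrite -[y](addKr x) addrC; apply: JD => //.
by rewrite -mulN1r; apply: JM.
Qed.

Lemma ideal_gen_min S J : is_ideal J -> S `<=` J -> ideal_gen S `<=` J.
Proof.
move=> Jid SJ x [s sS ->]; apply: is_ideal_sum => // p ps _.
by case: Jid => _ _; apply; apply/SJ/sS.
Qed.

Lemma ideal_gen_id J : is_ideal J -> ideal_gen J = J.
Proof.
by move=> Jid; apply/seteqP; split; [apply: ideal_gen_min | apply: ideal_gen_sub].
Qed.

Lemma prime_ideal_is_ideal J : prime_ideal J -> is_ideal J.
Proof.
move=> [[]]; rewrite !inE => J0 _ JM _.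
have JP a x y : J x -> J y -> J (a * x + y).
  by move=> Jx Jy; have := JM a x y; rewrite !inE; apply.
split=> // [x y Jx Jy|a x Jx]; first by rewrite -[x]mul1r; apply: JP.
by rewrite -[_ * _]addr0; apply: JP.
Qed.

Lemma prime_ideal_not1 J : prime_ideal J -> ~ J 1.
Proof. by move=> [[_ + _] _]; rewrite inE notin_setE. Qed.

Lemma prime_ideal_mul J x y : prime_ideal J -> J (x * y) -> J x \/ J y.
Proof.
move=> [_ /(_ x y)]; rewrite !inE => h Jxy.
by have /orP[/set_mem|/set_mem] := h Jxy; [left|right].
Qed.

End IdealGeneration.

(** * Monomials in the powers of a squarefree monomial ideal *)

Section PowerMembership.
Local Open Scope classical_set_scope.
Variable n : nat.
Implicit Types (G : set 'X_{1..n}) (v w m : 'X_{1..n}) (S : {set 'I_n}).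

(** This says that x^v lies in the t-th power of the ideal generated by the
    monomials x^g, g in G; see [ideal_powE]. *)
Definition in_pow G t v : Prop :=
  exists f : seq 'X_{1..n},
    [/\ size f = t, forall g, g \in f -> G g & (\sum_(g <- f) g <= v)%MM].

Lemma in_pow1 G v : in_pow G 1 v <-> exists2 g, G g & (g <= v)%MM.
Proof.
split=> [[f []]|[g Gg gv]]; last first.
  by exists [:: g]; split=> // [h|]; rewrite ?big_seq1 // inE => /eqP->.
case: f => [|g []] // _ Gf; rewrite big_seq1 => gv; exists g => //.
by apply: Gf; rewrite mem_head.
Qed.

Lemma in_pow_le G t v w : (v <= w)%MM -> in_pow G t v -> in_pow G t w.
Proof. by move=> vw [f [szf Gf /lepm_trans fv]]; exists f; split=> //; apply: fv. Qed.

Lemma in_powD G s t v w :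
  in_pow G s v -> in_pow G t w -> in_pow G (s + t) (v + w)%MM.
Proof.
move=> [f [<- Gf /mnm_lepP fv]] [h [<- Gh /mnm_lepP hw]].
exists (f ++ h); split=> [|g|]; first by rewrite size_cat.
  by rewrite mem_cat => /orP[/Gf|/Gh].
by apply/mnm_lepP=> i; rewrite big_cat !mnmDE leq_add.
Qed.

(** A sum of t squarefree exponents is at most t everywhere, so an exponent of
    w that is at least t imposes no condition. *)
Lemma in_pow_cap G t v w :
    (forall g, G g -> forall i, (g i <= 1)%N) ->
    (forall i, (w i < t)%N -> (v i <= w i)%N) ->
  in_pow G t v -> in_pow G t w.
Proof.
move=> sqf vw [f [szf Gf /mnm_lepP fv]]; exists f; split=> //.
apply/mnm_lepP=> i; have [/vw|] := ltnP (w i) t; first exact: leq_trans.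
apply: leq_trans; rewrite mnm_sumE -szf -sum1_size big_seq [leqRHS]big_seq.
by apply: leq_sum => g /Gf/sqf.
Qed.

(** The monomial x^v represents a nonzero socle element of the localization of
    R/I^t at the prime generated by the variables in S; see
    [Ass_ideal_powP]. *)
Definition socle G S t : Prop :=
  exists v, [/\ ~ in_pow G t v, forall i, i \notin S -> (t <= v i)%N &
                forall i, i \in S -> in_pow G t (v + U_(i))%MM].

End PowerMembership.

(** * Monomial ideals of the polynomial ring *)

Section MonomialIdeals.
Local Open Scope ring_scope.
Local Open Scope classical_set_scope.
Variables (K : fieldType) (n : nat).
Local Notation R := {mpoly K[n]}.
Implicit Types (G D : set 'X_{1..n}) (m v : 'X_{1..n}) (p q : R) (S : {set 'I_n}).

Definition spanned_by D : set R := [set p | forall m, m \in msupp p -> D m].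

Lemma spanned_by0 D : spanned_by D 0.
Proof. by move=> m; rewrite msupp0. Qed.

Lemma spanned_byD D p q : spanned_by D p -> spanned_by D q -> spanned_by D (p + q).
Proof. by move=> Dp Dq m /msuppD_le; rewrite mem_cat => /orP[/Dp|/Dq]. Qed.

Lemma spanned_by_mono D m : spanned_by D 'X_[m] <-> D m.
Proof.
split=> [|Dm m' /mem_msuppXP<- //]; apply; exact/mem_msuppXP.
Qed.

Lemma spanned_byM D1 D2 D3 p q :
    (forall m1 m2, D1 m1 -> D2 m2 -> D3 (m1 + m2)%MM) ->
  spanned_by D1 p -> spanned_by D2 q -> spanned_by D3 (p * q).
Proof.
move=> DD Dp Dq m /msuppM_le/allpairsP[[m1 m2] /= [/Dp D1m /Dq D2m ->]].
exact: DD.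
Qed.

Lemma spanned_by_ideal D :
  (forall m m', D m -> D (m' + m)%MM) -> is_ideal (spanned_by D).
Proof.
move=> up; split; [exact: spanned_by0 | exact: spanned_byD|] => a p.
by apply: (@spanned_byM setT) => // m1 m2 _; apply: up.
Qed.

Lemma spanned_by_sub D (J : set R) :
  is_ideal J -> (forall m, D m -> J 'X_[m]) -> spanned_by D `<=` J.
Proof.
move=> Jid DJ p Dp; rewrite [p]mpolyE; apply: is_ideal_sum => // m mp _.
by case: Jid => _ _ JM; rewrite -mul_mpolyC; apply/JM/DJ/Dp.
Qed.

(** The terms of p are sorted according to D; this replaces the reduction of p
    modulo a monomial ideal. *)
Lemma spanned_by_split D p : exists q r,
  [/\ p = q + r, spanned_by D q, spanned_by (~` D) r &
  forall m, m \in msupp r -> m \in msupp p].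
Proof.
pose part (P : pred 'X_{1..n}) : R := \sum_(m <- msupp p | P m) p@_m *: 'X_[m].
have part_supp P m : m \in msupp (part P) -> P m /\ m \in msupp p.
  move/msupp_sum_le/flatten_mapP=> [m']; rewrite mem_filter => /andP[Pm' m'p].
  by move/msuppZ_le/mem_msuppXP=> <-.
exists (part (fun m => `[< D m >])), (part (fun m => ~~ `[< D m >])); split.
- by rewrite {1}[p]mpolyE (bigID (fun m => `[< D m >])).
- by move=> m /part_supp[/asboolP].
- by move=> m /part_supp[/asboolPn].
by move=> m /part_supp[].
Qed.

Lemma in_pow_ideal G t : is_ideal (spanned_by (in_pow G t)).
Proof. by apply: spanned_by_ideal => m m'; apply/in_pow_le/lem_addl. Qed.

Lemma monomial_ideal_genE G : monomial_ideal_gen G = spanned_by (in_pow G 1) :> set R.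
Proof.
apply/seteqP; split.
  apply: ideal_gen_min (in_pow_ideal G 1) _ => _ [g Gg <-].
  by apply/spanned_by_mono/in_pow1; exists g => //; apply: lepm_refl.
have Iid := ideal_gen_ideal [set ('X_[u] : R) | u in G].
apply: spanned_by_sub => // m /in_pow1[g Gg gm]; case: Iid => _ _ IM.
by rewrite -(submK gm) mpolyXD; apply/IM/ideal_gen_sub; exists g.
Qed.

Lemma ideal_powE G t :
  ideal_pow (monomial_ideal_gen G) t = spanned_by (in_pow G t) :> set R.
Proof.
apply/seteqP; split.
  apply: ideal_gen_min (in_pow_ideal G t) _ => _ [f If ->].
  elim: t f If => [|t IHt] f If.
    rewrite big_ord0 => m _; exists [::]; split=> //.
    by apply/mnm_lepP=> i; rewrite big_nil mnm0E.
  rewrite big_ord_recl; apply: (@spanned_byM (in_pow G 1) (in_pow G t)).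
  - by move=> m1 m2; apply: in_powD.
  - by rewrite -monomial_ideal_genE; apply: If.
  by apply: IHt => i; apply: If.
have Pid : is_ideal (ideal_pow (monomial_ideal_gen G) t : set R).
  exact: ideal_gen_ideal.
apply: spanned_by_sub => // m [f [szf Gf fm]].
subst t; case: Pid => _ _ PM.
rewrite -(submK fm) mpolyXD; apply/PM/ideal_gen_sub.
exists (fun i : 'I_(size f) => 'X_[nth 0%MM f i]) => [i|].
  by apply: ideal_gen_sub; exists (nth 0%MM f i) => //; apply/Gf/mem_nth.
by rewrite -mprodXE (big_nth 0%MM) big_mkord.
Qed.

End MonomialIdeals.

(** * Associated primes of the powers *)

Section AssociatedPrimes.
Local Open Scope ring_scope.
Local Open Scope classical_set_scope.
Variables (K : fieldType) (n : nat).
Local Notation R := {mpoly K[n]}.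
Implicit Types (G : set 'X_{1..n}) (m v : 'X_{1..n}) (p q : R) (S : {set 'I_n}).

Definition meets S m : Prop := exists2 i, i \in S & m i != 0%N.

Definition monomial_prime S : set R := spanned_by (meets S).

Lemma meetsN S m : ~ meets S m -> forall i, i \in S -> m i = 0%N.
Proof. by move=> NSm i iS; apply/eqP/negP=> /negP mi; apply: NSm; exists i. Qed.

Lemma meetsD S m1 m2 : meets S (m1 + m2)%MM <-> meets S m1 \/ meets S m2.
Proof.
split=> [[i iS]|[] [i iS mi]].
- by rewrite mnmDE addn_eq0 negb_and => /orP[] mi; [left|right]; exists i.
- by exists i => //; rewrite mnmDE addn_eq0 (negPf mi).
by exists i => //; rewrite mnmDE addn_eq0 (negPf mi) andbF.
Qed.

Lemma monomial_prime_ideal S : is_ideal (monomial_prime S).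
Proof. by apply: spanned_by_ideal => m m' Sm; apply/meetsD; right. Qed.

Lemma monomial_primeX S i : monomial_prime S 'X_i <-> i \in S.
Proof.
split=> [/spanned_by_mono[j jS]|iS].
  by rewrite mnm1E; case: (i =P j) => [->|].
by apply/spanned_by_mono; exists i => //; rewrite mnm1E eqxx.
Qed.

Lemma monomial_prime_inj S1 S2 :
  monomial_prime S1 = monomial_prime S2 -> S1 = S2.
Proof.
move=> E; apply/setP=> i; have Xi S := monomial_primeX S i.
by apply/idP/idP=> /Xi; [rewrite E | rewrite -E] => /Xi.
Qed.

(** The polynomial ring is a domain, so the product has a leading monomial, and
    that monomial is a product of a monomial of p and one of q. *)
Lemma mul_spanned_by (P Q : set 'X_{1..n}) p q : p != 0 -> q != 0 ->
    spanned_by P p -> spanned_by Q q ->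
  exists m1 m2, [/\ P m1, Q m2, m2 \in msupp q &
                    (m1 + m2)%MM \in msupp (p * q)].
Proof.
move=> p0 q0 Pp Qq; have pq0 : p * q != 0 by rewrite mulf_neq0.
have /msuppM_le/allpairsP[[m1 m2] /= [m1p m2q E]] := mlead_supp pq0.
exists m1, m2; rewrite -E; split=> //; [exact: Pp | exact: Qq | exact: mlead_supp].
Qed.

(** Modulo [monomial_prime S] every polynomial is equivalent to one without the
    variables in S, and a product of two such nonzero polynomials has a
    monomial without these variables. *)
Lemma monomial_prime_prime S : prime_ideal (monomial_prime S).
Proof.
have [P0 PD PM] := monomial_prime_ideal S.
split.
  split=> [||a p q]; rewrite !inE; first exact: P0.
    apply/negP; rewrite inE -mpolyX0 => /spanned_by_mono[i _].
    by rewrite mnm0E.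
  by move=> Pp Pq; apply: PD => //; apply: PM.
move=> p q; rewrite !inE => Ppq.
have [Pp|NPp] := pselect (monomial_prime S p); first by rewrite mem_set.
have [Pq|NPq] := pselect (monomial_prime S q); first by rewrite orbC mem_set.
exfalso.
have [p1 [p2 [Ep Pp1 Np2 _]]] := spanned_by_split (meets S) p.
have [q1 [q2 [Eq Pq1 Nq2 _]]] := spanned_by_split (meets S) q.
have p20 : p2 != 0 by apply: contra_notN NPp => /eqP p20; rewrite Ep p20 addr0.
have q20 : q2 != 0 by apply: contra_notN NPq => /eqP q20; rewrite Eq q20 addr0.
have [m1 [m2 [Nm1 Nm2 _ m12]]] := mul_spanned_by p20 q20 Np2 Nq2.
suff /(_ _ m12)/meetsD[] : monomial_prime S (p2 * q2) by [].
apply: (@is_ideal_subr _ (monomial_prime S) (p1 * q + p2 * q1) (p2 * q2));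
  first exact: monomial_prime_ideal.
  by apply: PD; [rewrite mulrC|]; apply: PM.
by rewrite -addrA -mulrDr -Eq -mulrDl -Ep.
Qed.

Lemma prime_ideal_monomial (P : set R) m : prime_ideal P ->
  P 'X_[m] -> exists2 i, P 'X_i & m i != 0%N.
Proof.
move=> Ppr; apply: contraPP => NPm; rewrite mpolyXE_id.
apply: (big_ind (fun p => ~ P p)); first exact: prime_ideal_not1.
  by move=> p q NPp NPq /(prime_ideal_mul Ppr)[].
move=> i _; have [->|mi] := eqVneq (m i) 0%N.
  by rewrite expr0; apply: prime_ideal_not1.
have {mi}NPi : ~ P 'X_i by move=> Pi; apply: NPm; exists i.
elim: (m i) => [|k IHk]; first by rewrite expr0; apply: prime_ideal_not1.
by rewrite exprS => /(prime_ideal_mul Ppr)[].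
Qed.

(** Given P = (J : f) with J = I^t, let S be the set of variables in P, and
    multiply f by the t-th power of each of the other variables. As P is prime,
    this does not change (J : f). Every monomial of f outside J is then a
    witness v: multiplying it by a polynomial in the variables outside S cannot
    lead into J, by [in_pow_cap]. This also shows that P has no elements besides
    those of the monomial prime. *)
Theorem Ass_ideal_powP G t (P : set R) :
    (forall g, G g -> forall i, (g i <= 1)%N) ->
  Ass (ideal_pow (monomial_ideal_gen G) t) P <->
  exists2 S, P = monomial_prime S & socle G S t.
Proof.
move=> sqf; rewrite ideal_powE; set J := spanned_by _.
have Jid : is_ideal J := in_pow_ideal K G t; have [J0 JD JM] := Jid.
split=> [[Ppr [f EP]]|[S -> [v [NJv v_off v_on]]]]; last first.
  split; first exact: monomial_prime_prime.
  exists 'X_[v]; apply/seteqP; split=> g.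
    move=> Sg; apply: (@spanned_byM _ _ (meets S) [set v]) Sg _ => [m _ [i iS mi] ->|].
      apply: in_pow_le (v_on i iS); apply/mnm_lepP=> j.
      rewrite !mnmDE mnm1E addnC leq_add2r.
      by case: (i =P j) => // <-; rewrite lt0n.
    exact/spanned_by_mono.
  move=> Jgv m mg; apply: contrapT => /meetsN m_off; apply: NJv.
  apply: (@in_pow_cap _ _ _ (m + v)%MM) => // [i vi|].
    by rewrite mnmDE m_off //; apply: contraTT vi => /v_off; rewrite leqNgt.
  apply: Jgv; rewrite (perm_mem (msuppMX _ _)) addmC.
  exact: map_f.
have PE g : P g <-> J (g * f) by rewrite EP.
have Pid := prime_ideal_is_ideal Ppr; have [_ _ PM] := Pid.
(* S is the set of variables in P, and h replaces f. *)
pose S := [set i : 'I_n | `[< P 'X_i >]]%SET.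
have SE i : i \in S <-> P 'X_i by rewrite inE; split=> /asboolP.
pose x := [multinom if i \in S then 0%N else t | i < n].
pose h : R := f * 'X_[x].
have NPx : ~ P 'X_[x].
  move=> /(prime_ideal_monomial Ppr)[i /SE iS].
  by rewrite mnmE iS.
have hx m : m \in msupp h -> forall i, i \notin S -> (t <= m i)%N.
  rewrite (perm_mem (msuppMX _ _)) => /mapP[m' _ ->] i iS.
  by rewrite mnmDE mnmE (negPf iS) leq_addr.
have Jh g : P g -> J (g * h).
  by move=> /PE Pg; rewrite mulrA mulrC; apply: JM.
have [h1 [h2 [Eh Jh1 Nh2 h2h]]] := spanned_by_split (in_pow G t) h.
have h20 : h2 != 0.
  apply: contra_notN NPx => /eqP h20; apply/PE.
  by rewrite mulrC -/h Eh h20 addr0.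
(* J contains the multiples of h and of h1 by elements of P. *)
have Jh2 g : P g -> J (g * h2).
  move=> /Jh; rewrite Eh mulrDr; apply: is_ideal_subr => //; exact: JM.
have SP : monomial_prime S `<=` P.
  apply: spanned_by_sub => // m [i /SE Pi mi].
  by rewrite -(@submK _ U_(i)%MM m) ?lep1mP // mpolyXD; apply: PM.
exists S.
  apply/seteqP; split=> // g Pg.
  (* If g2 is nonzero, some monomial of g2 * h2 is one of h2 times variables
     outside S, hence not in J. *)
  have [g1 [g2 [Eg Pg1 Ng2 _]]] := spanned_by_split (meets S) g.
  have [g20|g20] := eqVneq g2 0; first by rewrite Eg g20 addr0.
  have {}Pg : P g2 by apply: (is_ideal_subr Pid (SP _ Pg1)); rewrite -Eg.
  have [m1 [m2 [/meetsN m1_off Nm2 m2h m12]]] := mul_spanned_by g20 h20 Ng2 Nh2.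
  case: Nm2; apply: (@in_pow_cap _ _ _ (m1 + m2)%MM) => // [i m2i|].
    rewrite mnmDE m1_off //; apply: contraTT m2i => iS.
    by rewrite -leqNgt; apply: hx iS; apply: h2h.
  exact: Jh2 Pg _ m12.
have h2_lead := mlead_supp h20; exists (mlead h2); split; first exact: Nh2.
  by move=> i iS; apply: hx iS; apply: h2h.
move=> i /SE/Jh2; apply; rewrite mulrC (perm_mem (msuppMX _ _)) addmC.
exact: map_f.
Qed.

End AssociatedPrimes.

Arguments monomial_prime K {n} S.

(** * Depth zero and depth at least one *)

Section Depth.
Local Open Scope ring_scope.
Local Open Scope classical_set_scope.
Variables (K : fieldType) (n : nat).
Local Notation R := {mpoly K[n]}.
Implicit Types (G : set 'X_{1..n}) (m v : 'X_{1..n}) (p q : R) (S : {set 'I_n}).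

Lemma irrelevant_ideal_sub :
  irrelevant_ideal K n `<=` monomial_prime K [set: 'I_n]%SET.
Proof.
apply: ideal_gen_min; first exact: monomial_prime_ideal.
by move=> _ [i _ <-]; apply/monomial_primeX; rewrite inE.
Qed.

Lemma ideal_gen_setU0 (J : set R) :
  is_ideal J -> ideal_gen (J `|` [set` ([::] : seq R)]) = J.
Proof. by move=> Jid; rewrite set_nil setU0 ideal_gen_id. Qed.

(** The witness x^v is killed by the whole irrelevant ideal, so no element of
    that ideal is regular modulo I^t. *)
Lemma depth_quot_socle G t : socle G [set: 'I_n]%SET t ->
  depth_quot (ideal_pow (monomial_ideal_gen G) t : set R) 0.
Proof.
rewrite ideal_powE; set J := spanned_by _; move=> [v [NJv _ v_on]].
have Jid : is_ideal J := in_pow_ideal K G t; have [J0 JD JM] := Jid.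
have NJX : ~ J 'X_[v] by move/spanned_by_mono.
split.
  exists [::]; split=> //; split=> //; rewrite ideal_gen_setU0 // => J1; apply: NJX.
  by rewrite -['X_[v]]mulr1; apply: JM.
move=> [|f s] // sm [/(_ 0%N isT 'X_[v])]; rewrite take0 !ideal_gen_setU0 //= => reg _.
case: NJX; apply: reg.
have /irrelevant_ideal_sub fm : irrelevant_ideal K n f.
  by apply: sm; rewrite /= mem_head.
apply: (@spanned_byM _ _ (meets [set: 'I_n]%SET) [set v]) fm _ => [m _ [i _ mi] ->|].
  apply: in_pow_le (v_on i _); last by rewrite inE.
  apply/mnm_lepP=> j; rewrite !mnmDE mnm1E addnC leq_add2r.
  by case: (i =P j) => // <-; rewrite lt0n.
exact/spanned_by_mono.
Qed.

(** If x^m is not in I, then I lies in P_S, where S is the set of variables not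
    occurring in m. The sum of all variables is not in P_S as long as S is not
    everything, so if f g is in I, then g is in P_S and x^m is not a monomial
    of g. For m = 1 one variable x_j has to be removed from S; P_S still
    contains I because no generator is a single variable. *)
Lemma regular_sum_variables G : (0 < n)%N ->
    (forall g, G g -> forall i, (g i <= 1)%N) ->
    (forall g, G g -> (1 < mdeg g)%N) ->
  regular_seq (monomial_ideal_gen G) [:: \sum_(i < n) 'X_i : R].
Proof.
move=> n_gt0 sqf deg2; set f : R := \sum_i _.
have Iid : is_ideal (monomial_ideal_gen G : set R) by apply: ideal_gen_ideal.
have NfP S : monomial_prime K S f -> forall i, i \in S.
  move=> Sf i; have [] : meets S U_(i)%MM.
    apply: Sf; rewrite mcoeff_msupp raddf_sum /= (bigD1 i) //= mcoeffX eqxx.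
    rewrite big1 ?addr0 ?oner_neq0 // => j ji; rewrite mcoeffX.
    case: eqP => // /mnmP/(_ j); rewrite !mnm1E eqxx eq_sym.
    by rewrite (negPf ji).
  by move=> j jS; rewrite mnm1E; case: (i =P j) => [->|].
have regf g : monomial_ideal_gen G (f * g) -> (monomial_ideal_gen G : set R) g.
  rewrite !monomial_ideal_genE => Ifg m mg; apply/in_pow1; apply: contrapT => NIm.
  (* x_j is a variable occurring in m, or an arbitrary one if m = 0. *)
  pose j : 'I_n := odflt (Ordinal n_gt0) [pick i | m i != 0%N].
  have mj : m = 0%MM \/ m j != 0%N.
    rewrite /j; case: pickP => [i mi|m0]; [by right | left].
    by apply/mnmP=> i; rewrite mnm0E; apply/eqP/negPn; rewrite m0.
  pose S := [set i : 'I_n | (m i == 0%N) && (i != j)]%SET.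
  have IS : spanned_by (in_pow G 1) `<=` monomial_prime K S.
    apply: spanned_by_sub; first exact: monomial_prime_ideal.
    move=> v /in_pow1[b Gb bv]; apply/spanned_by_mono.
    apply: contrapT => NSv; have bS i : i \in S -> b i = 0%N.
      move=> iS; have := mnm_lepP bv i.
      by rewrite (meetsN NSv iS) leqn0 => /eqP.
    case: mj => [m0|mj].
      have := deg2 _ Gb; rewrite ltnNge => /negP; apply.
      rewrite mdegE (bigD1 j) //= big1 ?addn0 ?sqf // => i ij.
      by apply: bS; rewrite inE m0 mnm0E ij.
    apply: NIm; exists b => //; apply/mnm_lepP=> i.
    have [mi|mi] := eqVneq (m i) 0%N; last first.
      by apply: leq_trans (sqf _ Gb i) _; rewrite lt0n.
    by rewrite bS // inE mi eqxx /=; apply: contraNneq mj => <-; rewrite mi.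
  have /(prime_ideal_mul (monomial_prime_prime K S))[/NfP/(_ j)|] := IS _ Ifg.
    by rewrite inE eqxx andbF.
  move=> /(_ m mg)[i]; rewrite inE => /andP[/eqP-> _].
  by [].
split=> [[|//] _ g|]; first by rewrite take0 !ideal_gen_setU0 //; apply: regf.
move=> I1; have /(_ 1 I1) : ideal_gen (monomial_ideal_gen G `|` [set` [:: f]])
    `<=` monomial_prime K [set: 'I_n]%SET.
  apply: ideal_gen_min; first exact: monomial_prime_ideal.
  move=> p [|]; last first.
    rewrite /= inE => /eqP->; apply: is_ideal_sum; first exact: monomial_prime_ideal.
    by move=> i _ _; apply/monomial_primeX; rewrite inE.
  rewrite monomial_ideal_genE; apply: spanned_by_sub; first exact: monomial_prime_ideal.
  move=> m /in_pow1[b Gb bm]; apply/spanned_by_mono; apply: contrapT => NTm.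
  have := deg2 _ Gb; rewrite ltnNge mdegE big1 // => i _.
  by apply/eqP; rewrite -leqn0 -(meetsN NTm (finset.in_setT i)) (mnm_lepP bm).
exact: (prime_ideal_not1 (monomial_prime_prime K _)).
Qed.

End Depth.

(** * Criteria for the existence of socle elements *)

Section SocleCriteria.
Local Open Scope classical_set_scope.
Variable n : nat.
Implicit Types (G : set 'X_{1..n}) (v m : 'X_{1..n}) (S A : {set 'I_n}).

Definition sdeg S v : nat := \sum_(i in S) v i.

(** A witness for [socle] whose non-membership in I^t is seen from its degree in
    the variables of S: the localized generators have degree at least r, so the
    degree of an element of the t-th power is at least t r. *)
Definition socle_cert G S t : Prop :=
  exists v r, [/\ forall g, G g -> (r <= sdeg S g)%N,
                  exists2 g, G g & sdeg S g = r,
                  (sdeg S v < t * r)%N,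
                  forall i, i \notin S -> (t <= v i)%N &
                  forall i, i \in S -> in_pow G t (v + U_(i))%MM].

Lemma sdegD S v m : sdeg S (v + m)%MM = (sdeg S v + sdeg S m)%N.
Proof. by rewrite /sdeg -big_split; apply: eq_bigr => i _; rewrite mnmDE. Qed.

Lemma sdeg_off S v m :
  (forall i, i \in S -> m i = 0%N) -> sdeg S (v + m)%MM = sdeg S v.
Proof. by move=> m0; rewrite sdegD [X in (_ + X)%N]big1 ?addn0. Qed.

Lemma socle_cert_socle G S t : socle_cert G S t -> socle G S t.
Proof.
move=> [v [r [Gr _ vr v_off v_on]]]; exists v; split=> // -[f [szf Gf fv]].
move: vr; rewrite ltnNge => /negP; apply.
apply: (@leq_trans (\sum_(g <- f) sdeg S g)).
  rewrite -szf -sum1_size big_distrl /= big_seq [leqRHS]big_seq.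
  by apply: leq_sum => g /Gf/Gr; rewrite mul1n.
rewrite /sdeg exchange_big /=; apply: leq_sum => i _; rewrite -mnm_sumE.
exact: (mnm_lepP fv).
Qed.

(** The witness is multiplied by a generator of S-degree exactly r, and by each
    variable outside S to keep those exponents at least t + 1. *)
Lemma socle_certS G S t : socle_cert G S t -> socle_cert G S t.+1.
Proof.
move=> [v [r [Gr [g Gg gr] vr v_off v_on]]].
pose x := [multinom if i \in S then 0%N else 1%N | i < n].
have x0 i : i \in S -> x i = 0%N by move=> iS; rewrite mnmE iS.
exists (g + v + x)%MM, r; split=> //; first by exists g.
- by rewrite sdeg_off // sdegD gr mulSn ltn_add2l.
- move=> i iS; rewrite !mnmDE mnmE (negPf iS) addn1 ltnS.
  exact: leq_trans (v_off i iS) (leq_addl _ _).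
move=> i iS; apply: (@in_pow_le _ _ _ (g + (v + U_(i)))%MM).
  by rewrite addmA; apply/mnm_lepP=> j; rewrite !mnmDE leq_add2r leq_addr.
apply: (@in_powD _ _ 1%N t _ _ _ (v_on i iS)).
by apply/in_pow1; exists g; rewrite ?lepm_refl.
Qed.

Lemma socle_cert_le G S s t : (s <= t)%N -> socle_cert G S s -> socle_cert G S t.
Proof.
by move=> /subnK<- Gs; elim: (t - s)%N => // k; rewrite addSn; apply: socle_certS.
Qed.

(** The variable x_i does not occur in the minimal generators of the localized
    ideal, so if x_i x^v is in its t-th power, so is x^v. *)
Lemma not_socle_loop G S i t : i \in S ->
    (forall g, G g -> exists h,
       [/\ G h, h i = 0%N & forall j, j \in S -> (h j <= g j)%N]) ->
    (forall g, G g -> forall i, (g i <= 1)%N) ->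
  ~ socle G S t.
Proof.
move=> iS loop sqf [v [NIv v_off /(_ i iS)[f [szf Gf fv]]]]; apply: NIv.
have [k [szk Gk ki kf]] : exists k : seq 'X_{1..n}, [/\ size k = size f,
    forall g, g \in k -> G g, (\sum_(g <- k) g)%MM i = 0%N &
    forall j, j \in S -> ((\sum_(g <- k) g)%MM j <= (\sum_(g <- f) g)%MM j)%N].
  elim: f Gf {szf fv} => [|g f IHf] Gf.
    by exists [::]; split=> // *; rewrite !big_nil ?mnm0E.
  have [|k [szk Gk ki kf]] := IHf; first by move=> h hf; apply: Gf; rewrite inE hf orbT.
  have [|h [Gh hi hg]] := loop g; first by apply: Gf; rewrite mem_head.
  exists (h :: k); split=> [|l||j jS]; first by rewrite /= szk.
  - by rewrite inE => /orP[/eqP->|/Gk].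
  - by rewrite big_cons mnmDE hi ki.
  by rewrite !big_cons !mnmDE leq_add ?hg ?kf.
apply: (@in_pow_cap _ _ _ (\sum_(g <- k) g)%MM) => // [j|]; last first.
  by exists k; split; rewrite ?szk ?lepm_refl.
case: (boolP (j \in S)) => [jS _|/v_off]; last by rewrite leqNgt => /negPf->.
have [<-|ij] := eqVneq i j; first by rewrite ki.
by apply: leq_trans (kf j jS) _; have := mnm_lepP fv j; rewrite mnmDE mnm1E (negPf ij) addn0.
Qed.

(** The localized ideal is a product of an ideal in the variables of A and one
    in the other variables of S. Multiplying by x_b shows that v is large enough
    in the variables of A, multiplying by x_a that it is so in the others. *)
Lemma not_socle_separation G S A a b t :
    a \in S -> a \in A -> b \in S -> b \notin A ->
    (forall g h, G g -> G h -> exists2 k, G k &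
       forall j, j \in S -> (k j <= if j \in A then g j else h j)%N) ->
    (forall g, G g -> forall i, (g i <= 1)%N) ->
  ~ socle G S t.
Proof.
move=> aS aA bS bA sep sqf [v [NIv v_off v_on]]; apply: NIv.
have [f [szf Gf /mnm_lepP fv]] := v_on b bS.
have [h [szh Gh /mnm_lepP hv]] := v_on a aS.
have [k [szk Gk kfh]] : exists k : seq 'X_{1..n}, [/\ size k = t,
    forall g, g \in k -> G g & forall j, j \in S -> ((\sum_(g <- k) g)%MM j <=
      if j \in A then (\sum_(g <- f) g)%MM j else (\sum_(g <- h) g)%MM j)%N].
  elim: t f h szf szh Gf Gh {v v_off v_on fv hv} => [|t IHt] [|g f] // [|g' h] //=.
    by exists [::]; split=> // *; rewrite !big_nil mnm0E.
  move=> [szf] [szh] Gf Gh.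
  have [||k [szk Gk kfh]] := IHt f h szf szh.
  - by move=> l lf; apply: Gf; rewrite inE lf orbT.
  - by move=> l lh; apply: Gh; rewrite inE lh orbT.
  have [||l Gl lgg] := sep g g'.
  - by apply: Gf; rewrite mem_head.
  - by apply: Gh; rewrite mem_head.
  exists (l :: k); split=> [|m|j jS]; first by rewrite /= szk.
    by rewrite inE => /orP[/eqP->|/Gk].
  rewrite !big_cons !mnmDE; have := lgg j jS; have := kfh j jS.
  by case: (j \in A) => ? ?; apply: leq_add.
apply: (@in_pow_cap _ _ _ (\sum_(g <- k) g)%MM) => // [j|]; last first.
  by exists k; split; rewrite ?szk ?lepm_refl.
case: (boolP (j \in S)) => [jS _|/v_off]; last by rewrite leqNgt => /negPf->.
apply: leq_trans (kfh j jS) _; move: (fv j) (hv j); rewrite !mnmDE !mnm1E.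
case: (boolP (j \in A)) => jA.
  by have /negPf-> : b != j by [apply: contraNneq bA => ->]; rewrite addn0.
by have /negPf-> : a != j by [apply: contraNneq jA => <-]; rewrite addn0.
Qed.

Lemma not_socle0 G t : (exists g, G g) ->
    (forall g, G g -> forall i, (g i <= 1)%N) -> ~ socle G finset.set0 t.
Proof.
move=> [g Gg] sqf [v [NIv v_off _]]; apply: NIv.
apply: (@in_pow_cap _ _ _ (\sum_(h <- nseq t g) h)%MM) => // [i|].
  by rewrite ltnNge v_off // finset.in_set0.
exists (nseq t g); split; rewrite ?size_nseq ?lepm_refl // => h.
by rewrite mem_nseq => /andP[_ /eqP->].
Qed.

(** This bounds the exponents of a witness on S, and so leaves finitely many
    candidates. *)
Lemma socle_lt G t v i :
    (forall g, G g -> forall i, (g i <= 1)%N) ->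
    ~ in_pow G t v -> in_pow G t (v + U_(i))%MM -> (v i < t)%N.
Proof.
move=> sqf NIv Iv; rewrite ltnNge; apply/negP=> vi; apply: NIv.
apply: in_pow_cap Iv => // j vj; rewrite mnmDE mnm1E.
by have /negPf-> : i != j by [apply: contraTneq vj => <-; rewrite -leqNgt]; rewrite addn0.
Qed.

End SocleCriteria.

(** * Computations with the 44 supports *)

(** Sets of variables and exponents are given by lists of 1-based indices; a list
    with repetitions stands for the exponent that counts its entries. *)
Section Supports.
Local Open Scope classical_set_scope.
Implicit Types (s u a b c : seq nat) (i j : 'I_8).

Definition G44 : set 'X_{1..8} := [set mnm_of_support s | s in [set` supports44]].

Definition vars s : {set 'I_8} := [set i : 'I_8 | (val i).+1 \in s]%SET.

Lemma mnm_of_supportE s i : mnm_of_support s i = count_mem i.+1 s.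
Proof. exact: mnmE. Qed.

Lemma mnm_of_support_cat s u :
  mnm_of_support (s ++ u) = (mnm_of_support s + mnm_of_support u)%MM.
Proof. by apply/mnmP=> i; rewrite mnmDE !mnm_of_supportE count_cat. Qed.

Lemma mnm_of_support_cons i u :
  mnm_of_support (i.+1 :: u) = (mnm_of_support u + U_(i))%MM.
Proof.
apply/mnmP=> j; rewrite mnmDE mnm1E !mnm_of_supportE /= addnC eqSS.
by congr (_ + nat_of_bool _); apply/eqP/eqP=> [/val_inj|->].
Qed.

Lemma iota_ord x : x \in iota 1 8 -> exists i : 'I_8, x = i.+1.
Proof.
rewrite mem_iota => /andP[x0 x9]; case: x x0 x9 => // k _ k8.
by exists (Ordinal (k8 : k < 8)).
Qed.

Lemma ord_iota i : i.+1 \in iota 1 8.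
Proof. by rewrite mem_iota /= ltnS. Qed.

Definition fits a u := all (fun x => count_mem x a <= count_mem x u) (iota 1 8).

Lemma fitsP a u : reflect (mnm_of_support a <= mnm_of_support u)%MM (fits a u).
Proof.
apply: (iffP allP) => [au|/mnm_lepP au x /iota_ord[i ->]].
  by apply/mnm_lepP=> i; rewrite !mnm_of_supportE; apply/au/ord_iota.
by have := au i; rewrite !mnm_of_supportE.
Qed.

(** In [covers t a u] the list a collects the supports chosen so far; testing
    [fits a u] at each step cuts the search for t generators. *)
Fixpoint covers t a u : bool :=
  fits a u && if t is t'.+1 then has (fun s => covers t' (s ++ a) u) supports44 else true.

Lemma coversS t a u : covers t.+1 a u =
  fits a u && has (fun s => covers t (s ++ a) u) supports44.
Proof. by []. Qed.

Lemma coversP t a u : reflect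
  (exists f : seq 'X_{1..8}, [/\ size f = t, forall g, g \in f -> G44 g &
     ((\sum_(g <- f) g) + mnm_of_support a <= mnm_of_support u)%MM]) (covers t a u).
Proof.
elim: t a => [|t IHt] a; rewrite ?coversS; apply: (iffP andP).
- by move=> [/fitsP au _]; exists [::]; rewrite big_nil add0m.
- by move=> [f [/size0nil-> _]]; rewrite big_nil add0m => /fitsP.
- move=> [_ /hasP[s ss /IHt[f [szf Gf fu]]]]; exists (mnm_of_support s :: f).
  split=> [|g|]; first by rewrite /= szf.
    by rewrite inE => /orP[/eqP->|/Gf //]; exists s.
  by rewrite big_cons [(_ s + _)%MM]addmC -addmA -mnm_of_support_cat.
move=> [[|g f] []] // [szf] Gf fu; split.
  by apply/fitsP/(lepm_trans _ fu)/lem_addl.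
have [s ss gs] : G44 g by apply: Gf; rewrite mem_head.
apply/hasP; exists s => //; apply/IHt; exists f; split=> // [h hf|].
  by apply: Gf; rewrite inE hf orbT.
by move: fu; rewrite big_cons mnm_of_support_cat gs addmA [(g + _)%MM]addmC.
Qed.

Lemma in_pow_covers t u :
  reflect (in_pow G44 t (mnm_of_support u)) (covers t [::] u).
Proof.
have m0 : mnm_of_support [::] = 0%MM by apply/mnmP=> i; rewrite !mnmE.
apply: (iffP (coversP _ _ _)) => -[f [szf Gf fu]]; exists f; split=> //;
  by move: fu; rewrite m0 addm0.
Qed.

Lemma sdeg_vars s u :
  {subset s <= iota 1 8} -> sdeg (vars s) (mnm_of_support u) = count (mem s) u.
Proof.
move=> s8; elim: u => [|x u IHu].
  by apply: big1 => i _; rewrite mnm_of_supportE.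
rewrite /= -IHu -cat1s mnm_of_support_cat sdegD; congr (_ + _)%N.
rewrite /sdeg (eq_bigr (fun i : 'I_8 => (x == i.+1) : nat)) => [|i _]; last first.
  by rewrite mnm_of_supportE /= addn0.
have [xs|xs] := boolP (x \in s); last first.
  by rewrite big1 // => i; rewrite inE => iS; case: eqP => // xi; rewrite xi iS in xs.
have [i xi] := iota_ord (s8 _ xs).
rewrite (bigD1 i) ?inE -?xi //= xi eqxx big1 // => j /andP[_ ji].
by rewrite eqSS; case: eqP => // /val_inj E; rewrite E eqxx in ji.
Qed.

Definition others s := [seq x <- iota 1 8 | x \notin s].

(** The exponent u, completed by t copies of each variable outside s. *)
Definition on_off t s u := u ++ flatten (nseq t (others s)).

Lemma on_off_off t s u i : i \notin vars s -> t <= mnm_of_support (on_off t s u) i.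
Proof.
rewrite inE => iS; rewrite mnm_of_supportE count_cat.
apply: leq_trans (leq_addl _ _); elim: t => //= t IHt.
rewrite count_cat -add1n leq_add // -has_count has_pred1 mem_filter.
by rewrite iS ord_iota.
Qed.

Lemma on_off_on t s u i : i \in vars s ->
  mnm_of_support (on_off t s u) i = count_mem i.+1 u.
Proof.
rewrite inE => iS; rewrite mnm_of_supportE count_cat.
rewrite [X in (_ + X)%N](_ : _ = 0%N) ?addn0 //.
elim: t => //= t IHt; rewrite count_cat IHt addn0; apply/eqP.
by rewrite -leqn0 leqNgt -has_count has_pred1 mem_filter iS.
Qed.

(** The Boolean form of [socle_cert], with the witness [on_off t s u]. *)
Definition certifies t s u r :=
  [&& size u < t * r, all (fun b => r <= count (mem s) b) supports44,
      has (fun b => count (mem s) b == r) supports44 &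
      all (fun x => covers t [::] (x :: on_off t s u)) s].

Lemma certifiesP t s u r :
  {subset s <= iota 1 8} -> certifies t s u r -> socle_cert G44 (vars s) t.
Proof.
move=> s8 /and4P[ur /allP rs /hasP[b bs /eqP br] /allP us].
exists (mnm_of_support (on_off t s u)), r; split.
- by move=> _ [c cs <-]; rewrite sdeg_vars //; apply: rs.
- by exists (mnm_of_support b); [exists b | rewrite sdeg_vars].
- rewrite sdeg_vars // count_cat [X in (_ + X)%N](_ : _ = 0%N).
    by rewrite addn0; apply: leq_ltn_trans ur; apply: count_size.
  elim: (t) => //= k; rewrite count_cat => ->; rewrite addn0; apply/eqP.
  by rewrite -leqn0 leqNgt -has_count; apply/hasPn=> x; rewrite mem_filter => /andP[].
- by move=> i; apply: on_off_off.
move=> i; rewrite inE => iS; rewrite -mnm_of_support_cons.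
exact/in_pow_covers/us.
Qed.

(** On s, every base contains the trace of a base that avoids x; this says that x
    is a loop of the contraction of the complement of s. *)
Definition has_loop s :=
  has (fun x => all (fun b => has (fun c => (x \notin c) &&
     all (fun y => count_mem y c <= count_mem y b) s) supports44) supports44) s.

Lemma G44_squarefree g : G44 g -> forall i, g i <= 1.
Proof.
have : all uniq supports44 by [].
by move=> /allP h [s /h us <-] i; rewrite mnm_of_supportE count_uniq_mem // leq_b1.
Qed.

Lemma has_loop_not_socle s t : {subset s <= iota 1 8} -> has_loop s ->
  ~ socle G44 (vars s) t.
Proof.
move=> s8 /hasP[x xs /allP loop]; have [i xi] := iota_ord (s8 _ xs).
apply: (@not_socle_loop _ _ _ i); last exact: G44_squarefree.
  by rewrite inE -xi.
move=> _ [b /loop/hasP[c cs /andP[xc /allP cb]] <-].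
exists (mnm_of_support c); split; first by exists c.
  by rewrite mnm_of_supportE -xi; apply: count_memPn.
by move=> j; rewrite inE !mnm_of_supportE => /cb.
Qed.

(** After contraction of {1, 2} the bases are the pairs with one element in
    {3, 7} and one in {4, 5, 6, 8}. *)
Lemma not_socle_345678 t : ~ socle G44 (vars [:: 3; 4; 5; 6; 7; 8]) t.
Proof.
have sep : all (fun b => all (fun c => has (fun d =>
    all (fun x => count_mem x d <= count_mem x (if x \in [:: 3; 7] then b else c))
      [:: 3; 4; 5; 6; 7; 8]) supports44) supports44) supports44 by lazy.
apply: (@not_socle_separation _ _ _ (vars [:: 3; 7])
  (Ordinal (isT : 2 < 8)) (Ordinal (isT : 3 < 8)));
  [by rewrite inE | by rewrite inE | by rewrite inE | by rewrite inE
  | | exact: G44_squarefree].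
move=> _ _ [b bs <-] [c cs <-].
have /hasP[d ds /allP dbc] := allP (allP sep b bs) c cs.
exists (mnm_of_support d); first by exists d.
move=> j; rewrite inE => jS; have := dbc _ jS; rewrite [j \in _]inE.
by case: ifP; rewrite !mnm_of_supportE.
Qed.

Fixpoint sublists s : seq (seq nat) :=
  if s is x :: s' then map (cons x) (sublists s') ++ sublists s' else [:: [::]].

Lemma filter_sublists (P : pred nat) s : [seq x <- s | P x] \in sublists s.
Proof.
elim: s => //= x s IHs; rewrite mem_cat; case: (P x); last by rewrite IHs orbT.
by rewrite (map_f (cons x)).
Qed.

Lemma vars_surj (S : {set 'I_8}) : exists s,
  [/\ vars s = S, {subset s <= iota 1 8} & s \in sublists (iota 1 8)].
Proof.
exists [seq x <- iota 1 8 | inord x.-1 \in S]; split; last exact: filter_sublists.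
  by apply/setP=> i; rewrite inE mem_filter ord_iota andbT /= inord_val.
exact: mem_subseq (filter_subseq _ _).
Qed.

(** For t = 2 the exponents of a witness on s are 0 or 1 by [socle_lt], and those
    outside s may be taken to be 2, so the sublists of s are all the candidates. *)
Definition refutes2 s := all (fun u => covers 2 [::] (on_off 2 s u) ||
  has (fun x => ~~ covers 2 [::] (x :: on_off 2 s u)) s) (sublists s).

Lemma refutes2P s : uniq s -> {subset s <= iota 1 8} -> refutes2 s ->
  ~ socle G44 (vars s) 2.
Proof.
move=> s_uniq s8 /allP chk [v [NIv v_off v_on]].
pose u := [seq x <- s | v (inord x.-1) != 0%N].
have uE i : i \in vars s -> mnm_of_support (on_off 2 s u) i = v i.
  move=> iS; have vi := socle_lt G44_squarefree NIv (v_on i iS).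
  rewrite on_off_on // count_uniq_mem; last exact: filter_uniq.
  rewrite mem_filter inord_val; move: iS; rewrite inE => ->; rewrite andbT.
  by case: (v i) vi => [|[]].
have /orP[/in_pow_covers u_in|/hasP[x xs /in_pow_covers]] := chk u (filter_sublists _ s).
  apply: NIv; apply: in_pow_cap u_in => [g /G44_squarefree //|i vi].
  by rewrite uE //; apply: contraLR vi => /v_off; rewrite -leqNgt.
have [i xi] := iota_ord (s8 _ xs).
have iS : i \in vars s by rewrite inE -xi.
apply; rewrite xi mnm_of_support_cons.
apply: in_pow_cap (v_on i iS) => [g /G44_squarefree //|j].
rewrite !mnmDE => uj; rewrite leq_add2r uE //.
apply: contraLR uj => /(on_off_off 2 u) uj; rewrite -leqNgt.
exact: leq_trans uj (leq_addr _ _).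
Qed.

Lemma not_socle2_1235678 : ~ socle G44 (vars [:: 1; 2; 3; 5; 6; 7; 8]) 2.
Proof. by apply: refutes2P; [|apply/allP|lazy]. Qed.

(** In each of the four parallel classes {3}, {7}, {2, 8}, {1, 5, 6} of the
    contraction of 4 the witness has degree 2, hence degree 8 = 3 * 3 - 1. *)
Lemma socle_1235678 t : 3 <= t -> socle G44 (vars [:: 1; 2; 3; 5; 6; 7; 8]) t.
Proof.
move=> t3; apply: socle_cert_socle; apply: socle_cert_le t3 _.
apply: (@certifiesP _ _ [:: 1; 1; 2; 2; 3; 3; 7; 7] 3); last by lazy.
exact/allP.
Qed.

Definition certified2 s :=
  has (fun r => has (fun u => certifies 2 s u r) (sublists s)) (iota 1 4).

(** The complements of the sets s with a loop are the sets that are not flats.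
    There remain the 50 proper flats: {1, 2}, {4}, and 48 flats for which some
    monomial certifies that the prime is associated to I^2. *)
Lemma socle44_classification : all (fun s => [|| nilp s, has_loop s,
    s == [:: 3; 4; 5; 6; 7; 8], s == [:: 1; 2; 3; 5; 6; 7; 8] | certified2 s])
  (sublists (iota 1 8)).
Proof. by lazy. Qed.

End Supports.

(** * The ideal is matroidal *)

Section Matroidal.
Local Open Scope classical_set_scope.
Implicit Types (s b c : seq nat) (i j : 'I_8).

(** No monomial properly divides another one of the same degree. *)
Lemma minimal_gens_of_degree (K : fieldType) n (G : set 'X_{1..n}) d :
  (forall g, G g -> mdeg g = d) ->
  minimal_monomial_gens (monomial_ideal_gen G : set {mpoly K[n]}) G.
Proof.
move=> degG; split=> // H HG GH; apply/seteqP; split=> // g Gg.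
have : (monomial_ideal_gen G : set {mpoly K[n]}) 'X_[g].
  by apply: ideal_gen_sub; exists g.
rewrite GH monomial_ideal_genE => /spanned_by_mono/in_pow1[h Hh hg].
suff -> : g = h by [].
have /eqP := degG _ Gg; rewrite -{1}(submK hg) mdegD (degG _ (HG _ Hh)).
by rewrite -[X in _ == X]add0n eqn_add2r mdeg_eq0 -{2}(submK hg) => /eqP->; rewrite add0m.
Qed.

Lemma G44_deg g : G44 g -> mdeg g = 4.
Proof.
have deg4 : all (fun b => count (mem (iota 1 8)) b == 4) supports44 by [].
move=> [b bs <-]; apply: etrans (eqP (allP deg4 b bs)).
by rewrite -sdeg_vars // mdegE; apply: eq_bigl => i; rewrite inE ord_iota.
Qed.

Definition exchange b x y := [seq z <- iota 1 8 | (z == y) || (z \in b) && (z != x)].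

Lemma exchange44 : all (fun b => all (fun c => all (fun x => (x \in c) ||
    has (fun y => (y \notin b) && (exchange b x y \in supports44)) c) b)
  supports44) supports44.
Proof. by lazy. Qed.

Lemma supports44_uniq b : b \in supports44 -> uniq b /\ {subset b <= iota 1 8}.
Proof.
have : all (fun b => uniq b && all (mem (iota 1 8)) b) supports44 by [].
by move=> /allP/[apply]/andP[? /allP].
Qed.

Lemma matroidal44 (K : fieldType) : matroidal (ideal44 K).
Proof.
have min44 := minimal_gens_of_degree K G44_deg.
split; exists G44; first by split=> // g /G44_squarefree.
split=> //; first by exists 4; apply: G44_deg.
move=> _ _ [b bs <-] [c cs <-] i.
have [[b_uniq b8] [c_uniq c8]] := (supports44_uniq bs, supports44_uniq cs).
rewrite !mnm_of_supportE !count_uniq_mem // => cb.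
have ib : i.+1 \in b by case: (_ \in b) cb; rewrite ?ltn0.
have ic : i.+1 \notin c by apply: contraL cb => ->; rewrite -leqNgt leq_b1.
have := allP (allP (allP exchange44 b bs) c cs) _ ib.
rewrite (negPf ic) => /hasP[y yc /andP[yb ys]].
have [j yj] := iota_ord (c8 _ yc); rewrite yj in yc yb ys.
exists j; rewrite !mnm_of_supportE !count_uniq_mem // yc (negPf yb); split=> //.
exists (exchange b i.+1 j.+1) => //; apply/mnmP=> k.
rewrite mnmDE mnmBE !mnm1E !mnm_of_supportE !count_uniq_mem ?filter_uniq ?iota_uniq //.
rewrite mem_filter ord_iota andbT !eqSS !(inj_eq val_inj) (eq_sym j) (eq_sym i).
have [->|kj] := eqVneq k j.
  by rewrite (negPf yb) sub0n.
have [->|ki] := eqVneq k i; first by rewrite ib.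
by rewrite andbT addn0 subn0.
Qed.

End Matroidal.

(** * The stability indices *)

Section StabilityIndices.
Local Open Scope classical_set_scope.

Lemma socle44_cases (S : {set 'I_8}) :
  [\/ forall t, ~ socle G44 S t, forall t, 2 <= t -> socle G44 S t
    | S = vars [:: 1; 2; 3; 5; 6; 7; 8]].
Proof.
have [s [<- s8 sl]] := vars_surj S.
have /or4P[/nilP->|sloop|/eqP->|/orP[/eqP->|]] := allP socle44_classification s sl.
- apply: Or31 => t; rewrite (_ : vars [::] = finset.set0); last first.
    by apply/setP=> i; rewrite !inE.
  apply: not_socle0 => [|g /G44_squarefree //].
  by exists (mnm_of_support [:: 1; 2; 3; 4]), [:: 1; 2; 3; 4].
- by apply: Or31 => t; apply: has_loop_not_socle.
- by apply: Or31 => t; apply: not_socle_345678.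
- exact: Or33.
move=> /hasP[r _ /hasP[u _ /certifiesP cert]]; apply: Or32 => t t2.
exact/socle_cert_socle/(socle_cert_le t2)/cert.
Qed.

Lemma socle44_stable (S : {set 'I_8}) t : 3 <= t -> socle G44 S t <-> socle G44 S 3.
Proof.
have [NS|St|->] := socle44_cases S => t3; first by split=> /NS.
  by split=> _; apply: St => //; apply: ltnW.
by split=> _; apply: socle_1235678.
Qed.

(** The rank is 4, so a witness of degree 7 = 2 * 4 - 1 is needed. *)
Lemma socle44_full t : 2 <= t -> socle G44 [set: 'I_8]%SET t.
Proof.
have varsT : vars (iota 1 8) = [set: 'I_8]%SET.
  by apply/setP=> i; rewrite finset.in_setT finset.in_set ord_iota.
rewrite -varsT => t2; apply/socle_cert_socle/(socle_cert_le t2).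
by apply: (@certifiesP _ _ [:: 1; 2; 3; 4; 5; 7; 8] 4); last by lazy.
Qed.

Lemma astab44 (K : fieldType) : astab (ideal44 K) 3.
Proof.
have AssE t P : Ass (ideal_pow (ideal44 K) t) P <->
    exists2 S, P = monomial_prime K S & socle G44 S t.
  by apply: Ass_ideal_powP => g /G44_squarefree.
split=> [|j [j1 stable]].
  split=> // t t3; apply/seteqP; split=> P /AssE[S -> St]; apply/AssE; exists S => //.
    exact/(socle44_stable S t3).
  exact/(socle44_stable S t3).
rewrite ltnNge; apply/negP=> j2; apply: not_socle2_1235678.
have : Ass (ideal_pow (ideal44 K) 2)
    (monomial_prime K (vars [:: 1; 2; 3; 5; 6; 7; 8])).
  rewrite stable // -(stable 3); last exact: leq_trans j2 _.
  by apply/AssE; exists (vars [:: 1; 2; 3; 5; 6; 7; 8]) => //; apply: socle_1235678.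
by move=> /AssE[S /monomial_prime_inj <-].
Qed.

Lemma dstab44 (K : fieldType) : dstab (ideal44 K) 2.
Proof.
have depth0 t : 2 <= t -> depth_quot (ideal_pow (ideal44 K) t) 0.
  by move=> /socle44_full/depth_quot_socle.
split=> [|j [j1 [d depth_d]]]; first by split=> //; exists 0%N.
rewrite ltnNge; apply/negP=> j_le1.
have d0 : d = 0%N.
  have [[s [sm s_reg <-]] _] : depth_quot (ideal_pow (ideal44 K) 2) d.
    by apply: depth_d; apply: leq_trans j_le1 _.
  by apply/eqP; rewrite -leqn0; apply: (depth0 2 isT).2.
have /depth_d[_ /(_ [:: \sum_(i < 8) 'X_i]%R)] := j_le1.
have -> : ideal_pow (ideal44 K) 1 = ideal44 K.
  by rewrite /ideal44 ideal_powE monomial_ideal_genE.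
rewrite d0 /= => /(_ _ _) len; suff : (1 <= 0)%N by [].
apply: len.
  move=> f; rewrite /= inE => /eqP->.
  apply: is_ideal_sum; first exact: ideal_gen_ideal.
  by move=> i _ _; apply: ideal_gen_sub; exists i.
by apply: regular_sum_variables => // g; [move/G44_squarefree|move/G44_deg->].
Qed.

End StabilityIndices.

Theorem mainTheorem2 (K : fieldType) :
  [/\ matroidal (ideal44 K), astab (ideal44 K) 3 & dstab (ideal44 K) 2].
Proof. by split; [exact: matroidal44 | exact: astab44 | exact: dstab44]. Qed.
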